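(* Consider the cascade model with $N=3$ processors, rates $\lambda_1,\lambda_2,\lambda_3>0$ and $\beta_{12},\beta_{23}>0$, started from a fixed initial state, and let $v^*_j=\lim_{t\to\infty}x_j(t)/t$ (limit in probability). Then: (1) if $\lambda_1<\min(\lambda_2,\lambda_3)$, the limits exist and $v^*_1=v^*_2=v^*_3=\lambda_1$; (2) if $\lambda_2>\lambda_1>\lambda_3$, the limits exist and $v^*_1=v^*_2=\lambda_1$, $v^*_3=\lambda_3$; (3) if $\lambda_2<\min(\lambda_1,\lambda_3)$, the limits exist and $v^*_1=\lambda_1$, $v^*_2=v^*_3=\lambda_2$; (4) if $\lambda_1>\lambda_2>\lambda_3$, the limits exist and $v^*_1=\lambda_1$, $v^*_2=\lambda_2$, $v^*_3=\lambda_3$.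
   Context: Cascade model with $N=3$: a continuous-time process $(x_1(t),x_2(t),x_3(t))\in\mathbb Z^3$. Mutually independent Poisson flows $\Pi^k$ of intensity $\lambda_k$ ($k=1,2,3$) and $\Pi^{12},\Pi^{23}$ of intensities $\beta_{12},\beta_{23}$. At each point of $\Pi^k$, $x_k$ increases by $1$. At each point $\sigma$ of $\Pi^{k,k+1}$, processor $k$ sends to processor $k+1$ a message carrying $x_k(\sigma)$, arriving instantly; if $x_{k+1}(\sigma)>x_k(\sigma)$ then $x_{k+1}(\sigma+0)=x_k(\sigma)$. When processor $2$ is rolled back at time $\sigma$ to value $x$, all messages sent by $2$ during $(\theta,\sigma)$, where $\theta=\max\{s\le\sigma:x_2(s)=x,\ x_2(s+0)=x+1\}$, are cancelled, and if for such a cancelled message sent at time $s'$ we have $x_3(\sigma)>x_2(s')$, then $x_3$ is rolled back to $x_2(s')$ (cascading rollback). *)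

(* Defs.v *)
From HB Require Import structures.
From mathcomp Require Import all_boot all_order all_algebra.
From mathcomp Require Import all_classical all_reals all_analysis.
Set Implicit Arguments. Unset Strict Implicit. Unset Printing Implicit Defensive.
Import Order.TTheory GRing.Theory Num.Theory.
Local Open Scope classical_set_scope.
Local Open Scope ring_scope.

(* Flows.  The five independent Poisson flows are indexed by 'I_5:          *)
(*   0 = Pi^1, 1 = Pi^2, 2 = Pi^3, 3 = Pi^{12}, 4 = Pi^{23}.                 *)
(* Each flow is given by its sequence of inter-arrival times tau k i        *)
(* (i = 0, 1, 2, ...); its n-th point (n = 0,1,...) is tau k 0 + ... + tau k n. *)

Definition rates {R : realType} (l1 l2 l3 b12 b23 : R) (k : 'I_5) : R :=
  match nat_of_ord k with
  | 0 => l1 | 1 => l2 | 2 => l3 | 3 => b12 | _ => b23 end.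

(* State of the cascade: values x1, x2, x3 and the history (log) of        *)
(* processor 2, most recent first: [inl x] = "x2 went from x to x+1",       *)
(* [inr v] = "2 sent to 3 a (not yet cancelled) message carrying v".        *)
Record cstate := CState { cx1 : int; cx2 : int; cx3 : int; clog : seq (int + int) }.

Definition init_state (a1 a2 a3 : int) : cstate := CState a1 a2 a3 [::].

Definition getr (e : int + int) : option int :=
  match e with inl _ => None | inr v => Some v end.

Definition is_up (e : int + int) : bool :=
  match e with inl _ => true | inr _ => false end.

(* Rollback of processor 2 to value x at time sigma: theta is the last time  *)
(* x2 went from x to x+1 (the first [inl x] in the log); every message sent  *)
(* by 2 after theta is cancelled, and for each cancelled message carrying v, *)
(* if x3 > v then x3 is rolled back to v.  If there is no such theta, all    *)
(* messages sent so far are cancelled.  Cancelled messages leave the log.    *)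
Definition rollback2 (x : int) (s : cstate) : cstate :=
  let i := find (fun e => e == inl x) (clog s) in
  let pre := take i (clog s) in
  let cancelled := pmap getr pre in
  CState (cx1 s) x
         (foldr (fun v m => Order.min v m) (cx3 s) cancelled)
         ([seq e <- pre | is_up e] ++ drop i (clog s)).

Definition apply_event (k : 'I_5) (s : cstate) : cstate :=
  match nat_of_ord k with
  | 0 => CState (cx1 s + 1) (cx2 s) (cx3 s) (clog s)
  | 1 => CState (cx1 s) (cx2 s + 1) (cx3 s) (inl (cx2 s) :: clog s)
  | 2 => CState (cx1 s) (cx2 s) (cx3 s + 1) (clog s)
  | 3 => if cx1 s < cx2 s then rollback2 (cx1 s) s else s
  | _ => CState (cx1 s) (cx2 s)
                (if cx2 s < cx3 s then cx2 s else cx3 s)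
                (inr (cx2 s) :: clog s)
  end.

Section Path.
Variable R : realType.
Variable tau : 'I_5 -> nat -> R.

Definition pt (k : 'I_5) (n : nat) : R := \sum_(i < n.+1) tau k i.

(* given the numbers c k of already processed points of each flow, the flow *)
(* owning the earliest unprocessed point *)
Definition next_flow (c : 'I_5 -> nat) : 'I_5 :=
  [arg min_(k < ord0) pt k (c k)]%O.

Definition bumpc (c : 'I_5 -> nat) (k : 'I_5) : 'I_5 -> nat :=
  fun k' => if k' == k then (c k').+1 else c k'.

Fixpoint sim (s0 : cstate) (j : nat) : ('I_5 -> nat) * cstate :=
  match j with
  | 0 => (fun _ => 0%N, s0)
  | j'.+1 => let cs := sim s0 j' in
             let k := next_flow cs.1 in
             (bumpc cs.1 k, apply_event k cs.2)
  end.

Definition etime (s0 : cstate) (j : nat) : R :=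
  let c := (sim s0 j).1 in pt (next_flow c) (c (next_flow c)).

(* number of events at times <= t (the event times are nondecreasing);   *)
(* defined as 0 on the null set where event times stay bounded.         *)
Definition nevents (s0 : cstate) (t : R) : nat :=
  match pselect (exists j, t < etime s0 j) with
  | left h => ex_minn h
  | right _ => 0%N
  end.

(* state at time t (right-continuous: events at times <= t are applied) *)
Definition state_at (s0 : cstate) (t : R) : cstate := (sim s0 (nevents s0 t)).2.

End Path.

Definition mutually_independent {d} {T : measurableType d} {R : realType}
  (P : probability T R) {I : eqType} (X : I -> T -> R) : Prop :=
  forall (J : seq I) (B : I -> set R), uniq J -> (forall i, measurable (B i)) ->
    P (\bigcap_(i in [set` J]) (X i @^-1` B i)) =
    (\prod_(i <- J) P (X i @^-1` B i))%E.

Definition cvg_in_prob {d} {T : measurableType d} {R : realType}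
  (P : probability T R) (Y : R -> T -> R) (v : R) : Prop :=
  forall eps delta : R, 0 < eps -> 0 < delta ->
    exists M : R, forall t, M < t ->
      (P [set w | (eps < `|Y t w - v|)%R] <= delta%:E)%E.

Definition speed {T : Type} {R : realType} (tau : 'I_5 -> nat -> T -> R)
  (s0 : cstate) (proj : cstate -> int) : R -> T -> R :=
  fun t w => (proj (state_at (fun k n => tau k n w) s0 t))%:~R / t.

(* Main.v *)
Require Import Defs.
From HB Require Import structures.
From mathcomp Require Import all_boot all_order all_algebra.
From mathcomp Require Import all_classical all_reals all_analysis.
From mathcomp Require Import measurable_realfun.
From mathcomp Require Import zify lra ring.
Import Order.TTheory GRing.Theory Num.Theory.
Import numFieldNormedType.Exports.
Local Open Scope classical_set_scope.
Local Open Scope ring_scope.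

(* Along the sequence of events, x2 is the minimum of its free growth and of
   the values x1(sigma) received at message times sigma plus the growth since
   sigma.  A cascading rollback never pushes x3 below the value to which
   processor 2 has just been rolled back, so x3 is bounded on both sides by the
   same kind of reflection at x2.  If every flow follows its rate uniformly on
   [0, t] within an error K, then x2 and x3 stay within O(K + 1) of
   min(l1, l2) t and min(l1, l2, l3) t.  That K = o(t) with high probability is
   the weak law of large numbers (Chebyshev) for the arrival times at finitely
   many grid points, made uniform by monotonicity. *)

(** * Pathwise bounds along the sequence of events *)

(** The obstacle is that [x2] is not monotone and that [x3] can also be lowered at points of the
    flow from 1 to 2. Because of the former, the bounds on [x3] refer to [x2] at an intermediate
    index [m]; the estimate for [x2] holds at all indices up to [n], so it can be inserted there.
    The latter is harmless: a cascade lowers [x3] only at an event that sets [x2] to [x1], so for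
    the lower bound it acts like one more message. The message intensities enter only through the
    time elapsed since the last message, which is O((1 + K) / b); they affect the error but not the
    speeds. The four regimes need no separate analysis, being evaluations of the two minima. *)

Local Notation fl1 := (@Ordinal 5 0 isT).
Local Notation fl2 := (@Ordinal 5 1 isT).
Local Notation fl3 := (@Ordinal 5 2 isT).
Local Notation fl12 := (@Ordinal 5 3 isT).
Local Notation fl23 := (@Ordinal 5 4 isT).

Lemma flow_ind (Q : 'I_5 -> Prop) :
  Q fl1 -> Q fl2 -> Q fl3 -> Q fl12 -> Q fl23 -> forall k, Q k.
Proof.
move=> q1 q2 q3 q4 q5 [[|[|[|[|[|//]]]]] ik].
all: by rewrite (bool_irrelevance ik isT).
Qed.

(** Recursive form of the list of messages cancelled by [rollback2]. If the log has no [inl y], it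
    is the list of all messages, as there. *)
Fixpoint sent_since (y : int) (l : seq (int + int)) : seq int :=
  match l with
  | [::] => [::]
  | inl z :: l' => if z == y then [::] else sent_since y l'
  | inr v :: l' => v :: sent_since y l'
  end.

Lemma cancelledE (y : int) (l : seq (int + int)) :
  pmap getr (take (find (fun e => e == inl y) l) l) = sent_since y l.
Proof.
elim: l => [//|[z|v] l IH] /=; last by rewrite IH.
have -> : ((inl z : int + int) == inl y) = (z == y) by [].
by case: ifP => //= _; rewrite IH.
Qed.

(** Since a rollback keeps every passage [inl z] in the log, the scan for [inl y] stops at the same
    passage as before and meets only messages that it met before. *)
Lemma sent_since_erase (y : int) (i : nat) (l : seq (int + int)) :
  {subset sent_since y ([seq e <- take i l | is_up e] ++ drop i l)
     <= sent_since y l}.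
Proof.
elim: l i => [//|e l IH] [|i] v; first by rewrite take0 drop0.
case: e => [z|u] /=; first by case: ifP => // _; exact: IH.
by move=> /IH vl; rewrite inE vl orbT.
Qed.

(* Whenever processor 2 passes [y] upwards it logs [inl y], so that every
   message sent since the last such passage carries a value at least [y]. *)
Definition log_sound (s : cstate) :=
  forall y v : int, y < cx2 s -> v \in sent_since y (clog s) -> y <= v.

Lemma log_sound_apply_event (k : 'I_5) (s : cstate) :
  log_sound s -> log_sound (apply_event k s).
Proof.
move=> sP; elim/flow_ind: k => //.
(* Either [y] is the value just left, and the log now starts with its passage, or [y] was already
   below [x2]. *)
- move=> y v /= ylt; case: eqP => // ne; apply: sP.
  by move: ne ylt; lia.
- rewrite /apply_event /=; case: ifP => // x12 y v /= ylt.
  move=> /sent_since_erase; apply: sP; lia.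
- move=> y v /= ylt; rewrite inE => /orP[/eqP->|]; first exact: ltW.
  exact: sP.
Qed.

Lemma foldr_min_le (m : int) (l : seq int) :
  foldr (fun v n => Order.min v n) m l <= m.
Proof. elim: l => //= v l; lia. Qed.

Lemma foldr_min_ge (x m : int) (l : seq int) :
  {in l, forall v, x <= v} ->
  Order.min x m <= foldr (fun v n => Order.min v n) m l.
Proof.
elim: l => [|v l IH] xl /=; first lia.
have := xl v (mem_head _ _).
have : Order.min x m <= foldr (fun v n => Order.min v n) m l.
  by apply: IH => u ul; apply: xl; rewrite inE ul orbT.
by move=> IHl xv; rewrite le_min IHl andbT ge_min xv.
Qed.

(** The cancelled messages are those of [sent_since x], so [log_sound] at [y := x] gives each of
    them a value at least [x]. *)
Lemma rollback2_x3 (s : cstate) (x : int) : log_sound s -> x < cx2 s ->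
  Order.min x (cx3 s) <= cx3 (rollback2 x s) <= cx3 s.
Proof.
move=> sP xs; rewrite /= cancelledE foldr_min_le andbT.
by apply: foldr_min_ge => v; exact: sP.
Qed.

Section Counts.
Context {R : realType} (tau : 'I_5 -> nat -> R) (s0 : cstate).
Local Notation c j := (sim tau s0 j).1.

Lemma count_le i j k : (i <= j)%N -> (c i k <= c j k)%N.
Proof.
elim: j => [|j IH]; first by rewrite leqn0 => /eqP->.
rewrite leq_eqVlt => /orP[/eqP->//|]; rewrite ltnS => /IH /leq_trans; apply.
by rewrite /= /bumpc; case: ifP.
Qed.

(** The witness [i] indexes the state just before the most recent point of flow [k]. *)
Lemma last_event j k : (0 < c j k)%N ->
  exists i, (i < j)%N /\ c j k = (c i k).+1.
Proof.
elim: j => [//|j IH] /=; rewrite /bumpc; case: ifP => [_ _|_ /IH[i [ij ->]]].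
  by exists j.
by exists i; split => //; exact: ltnW.
Qed.

End Counts.

Section Bounds.
Context {R : realType} (tau : 'I_5 -> nat -> R) (a1 a2 a3 : int).
Let s0 := init_state a1 a2 a3.
Local Notation c j := (sim tau s0 j).1.
Local Notation S j := (sim tau s0 j).2.

Lemma sim_log_sound j : log_sound (S j).
Proof. by elim: j => [//|j IH] /=; exact: log_sound_apply_event. Qed.

Lemma x1E j : cx1 (S j) = a1 + (c j fl1)%:Z.
Proof.
elim: j => [|j /=]; first by rewrite addr0.
elim/flow_ind: (next_flow _ _); rewrite /bumpc /apply_event /=
  -?val_eqE /=; try lia.
by case: ifP => /=; lia.
Qed.

Lemma x2_le j : cx2 (S j) <= a2 + (c j fl2)%:Z.
Proof.
elim: j => [|j /=]; first by rewrite addr0.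
elim/flow_ind: (next_flow _ _); rewrite /bumpc /apply_event /=
  -?val_eqE /=; try lia.
by case: ifP => /=; lia.
Qed.

(** Right after a message [x2 <= x1], whether or not it caused a rollback. Later [x1] only grows,
    and [x2] gains at most the points of its own flow, counted here from [i], which precedes the
    message. *)
Lemma x2_le_x1 i j : (i <= j)%N -> (c i fl12 < c j fl12)%N ->
  cx2 (S j) <= cx1 (S j) + (c j fl2)%:Z - (c i fl2)%:Z.
Proof.
elim: j => [|j IH]; first by rewrite leqn0 => /eqP->; rewrite ltnn.
rewrite leq_eqVlt => /orP[/eqP->|]; first by rewrite ltnn.
rewrite ltnS => ij; have := count_le tau s0 i j fl2 ij.
move: (IH ij); clear IH => /=.
elim/flow_ind: (next_flow _ _); rewrite /bumpc /apply_event /=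
  -?val_eqE /=; try lia.
by case: ifP => /=; lia.
Qed.

(** The witness is the index of the last effective rollback, where [x2] was set to [x1], or 0 if
    there was none; the minimum of [a1] and [a2] covers both cases. *)
Lemma x2_ge j : exists i, (i <= j)%N /\
  Order.min a1 a2 + (c i fl1)%:Z + (c j fl2)%:Z - (c i fl2)%:Z <= cx2 (S j).
Proof.
elim: j => [|j [i [ij IH]]]; first by exists 0%N; split => //=; lia.
have := x1E j; have [x12|x12] :=
  boolP ((next_flow tau (c j) == fl12) && (cx1 (S j) < cx2 (S j))).
  exists j; split => //=; move/andP: x12 => [/eqP -> x12].
  rewrite /bumpc /apply_event /= -?val_eqE /= x12 /=; lia.
exists i; split; first exact: leqW.
move: IH x12 => /=.
elim/flow_ind: (next_flow _ _); rewrite /bumpc /apply_event /=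
  -?val_eqE /=; try lia.
by case: ifP => /=; lia.
Qed.

Lemma x3_le j : cx3 (S j) <= a3 + (c j fl3)%:Z.
Proof.
elim: j => [|j /=]; first by rewrite addr0.
elim/flow_ind: (next_flow _ _); rewrite /bumpc /apply_event /=
  -?val_eqE /=; try lia.
  case: ifP => x12; last lia.
  have /andP[_] := rollback2_x3 (S j) (cx1 (S j)) (sim_log_sound j) x12.
  by move: (rollback2 _ _) => s'; lia.
by case: ifP => /=; lia.
Qed.

(** Here [m] is the index at which the last message was sent. Unlike [x1], [x2] may have dropped
    since then, so its value at [m] cannot be traded for the one at [j]. *)
Lemma x3_le_x2 i j : (i <= j)%N -> (c i fl23 < c j fl23)%N ->
  exists m, [/\ (i <= m)%N, (m <= j)%N &
    cx3 (S j) <= cx2 (S m) + (c j fl3)%:Z - (c m fl3)%:Z].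
Proof.
elim: j => [|j IH]; first by rewrite leqn0 => /eqP->; rewrite ltnn.
rewrite leq_eqVlt => /orP[/eqP->|]; first by rewrite ltnn.
rewrite ltnS => ij lt; have [e|ne] := eqVneq (next_flow tau (c j)) fl23.
  exists j; split => //=; rewrite e /bumpc /apply_event /= -?val_eqE /=.
  by case: ifP; lia.
have /(IH ij) [m [im mj H]] : (c i fl23 < c j fl23)%N.
  by move: lt; rewrite /= /bumpc eq_sym (negbTE ne).
exists m; split => //; first exact: leqW.
move: ne H {lt IH}; rewrite /=; move: (cx2 (S m)) (c m fl3) => X C.
elim/flow_ind: (next_flow _ _) => //; rewrite /bumpc /apply_event /=
  -?val_eqE /=; try lia.
case: ifP => x12; last lia.
have /andP[_] := rollback2_x3 (S j) (cx1 (S j)) (sim_log_sound j) x12.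
by move: (rollback2 _ _) => s'; lia.
Qed.

Lemma x3_ge j : a3 + (c j fl3)%:Z <= cx3 (S j) \/
  exists m, (m <= j)%N /\ cx2 (S m) + (c j fl3)%:Z - (c m fl3)%:Z <= cx3 (S j).
Proof.
elim: j => [|j IH]; first by left; rewrite /= addr0.
have [p0|np0] := boolP (a3 + (c j.+1 fl3)%:Z <= cx3 (S j.+1)); first by left.
(* Either [x3] keeps up with its free growth at this event and the previous alternative persists, or
   the event rolls [x3] back. *)
right; have [x3lt|x3ge] :=
    ltP (cx3 (S j.+1)) (cx3 (S j) + (c j.+1 fl3)%:Z - (c j fl3)%:Z); last first.
  case: IH => [p0|[m [mj H]]]; first by move: np0; lia.
  by exists m; split; [exact: leqW|lia].
have [e|ne] := eqVneq (next_flow tau (c j)) fl23.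
  exists j; split => //; move: x3lt.
  rewrite /= e /bumpc /apply_event /= -?val_eqE /=.
  by case: ifP; lia.
(* Only a cascade remains: [x3] stays at or above the value that [x2] has just received, so the
   witness is the state after the event. *)
exists j.+1; split => //; move: ne x3lt => /=.
elim/flow_ind: (next_flow _ _) => //; rewrite /bumpc /apply_event /=
  -?val_eqE /=; try lia.
case: ifP => x12; last lia.
have /andP[] := rollback2_x3 (S j) (cx1 (S j)) (sim_log_sound j) x12.
have : cx2 (rollback2 (cx1 (S j)) (S j)) = cx1 (S j) by [].
by move: (rollback2 _ _) => s'; lia.
Qed.

(** * Comparison of the event counts with linear growth *)

Section Fluid.
Variables (l1 l2 l3 b12 b23 K : R) (u : nat -> R) (n : nat).
Hypotheses (l1_gt0 : 0 < l1) (l2_gt0 : 0 < l2) (l3_gt0 : 0 < l3).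
Hypotheses (b12_gt0 : 0 < b12) (b23_gt0 : 0 < b23).
Hypothesis u_ge0 : forall j, (j <= n)%N -> 0 <= u j.
Hypothesis u_le : forall i j, (i <= j <= n)%N -> u i <= u j.
Hypothesis count_near : forall j k, (j <= n)%N ->
  `|(c j k)%:R - rates l1 l2 l3 b12 b23 k * u j| <= K.

Let count_ge j k : (j <= n)%N ->
  rates l1 l2 l3 b12 b23 k * u j - K <= (c j k)%:R.
Proof. by move=> /count_near - /(_ k); rewrite ler_norml => /andP[]; lra. Qed.
Let count_leK j k : (j <= n)%N ->
  (c j k)%:R <= rates l1 l2 l3 b12 b23 k * u j + K.
Proof. by move=> /count_near - /(_ k); rewrite ler_norml => /andP[]; lra. Qed.

Let K_ge0 : 0 <= K.
Proof. exact: le_trans (count_near 0 fl1 (leq0n _)). Qed.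

Let a1_abs : - `|a1%:~R| <= (a1%:~R : R) <= `|a1%:~R|.
Proof. by rewrite -ler_norml. Qed.
Let a2_abs : - `|a2%:~R| <= (a2%:~R : R) <= `|a2%:~R|.
Proof. by rewrite -ler_norml. Qed.
Let a3_abs : - `|a3%:~R| <= (a3%:~R : R) <= `|a3%:~R|.
Proof. by rewrite -ler_norml. Qed.

Lemma x1_fluid j : (j <= n)%N ->
  `|(cx1 (S j))%:~R - l1 * u j| <= `|a1%:~R| + K.
Proof.
move=> jn; rewrite x1E intrD -pmulrn.
move: (count_ge j fl1 jn) (count_leK j fl1 jn) a1_abs; rewrite /rates /=.
by rewrite ler_norml => ? ? /andP[? ?]; apply/andP; split; lra.
Qed.

(** The term [3 * K] comes from three counts, each known within [K]; the last term is the growth of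
    [x2] since the last message. *)
Let C2 := `|a1%:~R| + `|a2%:~R| + 3 * K + l2 * ((1 + 2 * K) / b12).

(** A single point of flow [k] falls between [i] and [j], so its rate times the elapsed time is at
    most one plus two errors [K]. *)
Lemma last_message_gap j k : (j <= n)%N -> 0 < rates l1 l2 l3 b12 b23 k ->
  (0 < c j k)%N -> exists i, [/\ (i <= j)%N, (c i k < c j k)%N &
    u j - u i <= (1 + 2 * K) / rates l1 l2 l3 b12 b23 k].
Proof.
move=> jn rk0 /last_event[i [ij ckE]]; exists i.
split; [exact: ltnW|by rewrite ckE|].
rewrite ler_pdivlMr // mulrC.
move: (count_ge j k jn) (count_leK i k (leq_trans (ltnW ij) jn)).
rewrite ckE -natr1; lra.
Qed.

Lemma x2_fluid j : (j <= n)%N ->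
  `|(cx2 (S j))%:~R - Num.min l1 l2 * u j| <= C2.
Proof.
move=> jn; have uj0 := u_ge0 j jn.
have D0 : 0 <= (1 + 2 * K) / b12 by rewrite divr_ge0 ?ltW //; move: K_ge0; lra.
have lD0 : 0 <= l2 * ((1 + 2 * K) / b12) by rewrite mulr_ge0 // ltW.
move: (a1_abs) (a2_abs) (K_ge0) => /andP[? ?] /andP[? ?] ?.
rewrite ler_norml; apply/andP; split.
  (* Up to the last rollback the growth has rate [l1], afterwards [l2], and both are at least the
     minimum. *)
  have [i [ij H]] := x2_ge j.
  have iN := leq_trans ij jn; have uij : u i <= u j by rewrite u_le // ij.
  have := u_ge0 i iN.
  move: H; rewrite -(ler_int R) !(rmorphD, rmorphB) /= -!pmulrn => H u0.
  have A : - (`|a1%:~R| + `|a2%:~R|) <= (Order.min a1 a2)%:~R :> R.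
    by rewrite /Order.min; case: ifP => _;
      move: (normr_ge0 (a1%:~R:R)) (normr_ge0 (a2%:~R:R)); lra.
  move: (count_leK i fl2 iN) (count_ge i fl1 iN) (count_ge j fl2 jn).
  rewrite /rates /= /C2.
  have V1 : Num.min l1 l2 * u i <= l1 * u i by rewrite ler_wpM2r // ge_min lexx.
  have V2 : Num.min l1 l2 * (u j - u i) <= l2 * (u j - u i).
    by rewrite ler_wpM2r ?subr_ge0 // ge_min lexx orbT.
  lra.
have X2 : (cx2 (S j))%:~R <= `|a2%:~R| + l2 * u j + K :> R.
  have := x2_le j; rewrite -(ler_int R) intrD -pmulrn.
  by move: (count_leK j fl2 jn); rewrite /rates /=; lra.
have ? := normr_ge0 (a1%:~R : R); have ? := normr_ge0 (a2%:~R : R).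
(* If [l2 < l1], free growth already gives the bound. Otherwise the last message is used, and if
   there was none, [u j] itself is small. *)
have [l12|l21] := leP l1 l2; last by rewrite /C2; lra.
have [c0|c0] := posnP (c j fl12).
  have bK : u j <= (1 + 2 * K) / b12.
    rewrite ler_pdivlMr // mulrC; move: (count_ge j fl12 jn).
    by rewrite c0 /rates /=; lra.
  have := ler_wpM2l (ltW l2_gt0) bK.
  have : 0 <= l1 * u j by rewrite mulr_ge0 // ltW.
  by rewrite /C2; lra.
have [i [ij lt bK]] := last_message_gap j fl12 jn b12_gt0 c0.
have := ler_wpM2l (ltW l2_gt0) bK.
have := x2_le_x1 i j ij lt.
rewrite x1E -(ler_int R) !(rmorphD, rmorphB) /= -!pmulrn.
move: (count_leK j fl1 jn) (count_leK j fl2 jn).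
move: (count_ge i fl2 (leq_trans ij jn)).
by rewrite /C2 /rates /=; lra.
Qed.

Let C3 := C2 + `|a3%:~R| + 3 * K + l3 * ((1 + 2 * K) / b23).

(** Same scheme with [x2] in the role of [x1]: replacing [x2] by [v2 * u] costs [C2]. *)
Lemma x3_fluid j : (j <= n)%N ->
  `|(cx3 (S j))%:~R - Num.min (Num.min l1 l2) l3 * u j| <= C3.
Proof.
set v2 := Num.min l1 l2; move=> jn; have uj0 := u_ge0 j jn.
have v20 : 0 < v2 by rewrite lt_min l1_gt0.
have D0 : 0 <= (1 + 2 * K) / b23 by rewrite divr_ge0 ?ltW //; move: K_ge0; lra.
have lD0 : 0 <= l3 * ((1 + 2 * K) / b23) by rewrite mulr_ge0 // ltW.
have C20 : 0 <= C2 := le_trans (normr_ge0 _) (x2_fluid 0 (leq0n _)).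
move: (a3_abs) (K_ge0) => /andP[? ?] ?.
have ? := normr_ge0 (a3%:~R : R).
rewrite ler_norml; apply/andP; split.
  have [H|[i [ij H]]] := x3_ge j.
    have V3 : Num.min v2 l3 * u j <= l3 * u j.
      by rewrite ler_wpM2r // ge_min lexx orbT.
    move: H (count_ge j fl3 jn).
    rewrite -(ler_int R) intrD -pmulrn /rates /= /C3.
    by lra.
  have iN := leq_trans ij jn; have uij : u i <= u j by rewrite u_le // ij.
  have ui0 := u_ge0 i iN.
  move: H; rewrite -(ler_int R) !(rmorphD, rmorphB) /= -!pmulrn => H.
  move: (count_leK i fl3 iN) (count_ge j fl3 jn) (x2_fluid i iN).
  rewrite ler_norml -/v2 /rates /= => ? ? /andP[+ _]; move: H.
  have V1 : Num.min v2 l3 * u i <= v2 * u i by rewrite ler_wpM2r // ge_min lexx.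
  have V2 : Num.min v2 l3 * (u j - u i) <= l3 * (u j - u i).
    by rewrite ler_wpM2r ?subr_ge0 // ge_min lexx orbT.
  by rewrite /C3; lra.
have X3 : (cx3 (S j))%:~R <= `|a3%:~R| + l3 * u j + K :> R.
  have := x3_le j; rewrite -(ler_int R) intrD -pmulrn.
  by move: (count_leK j fl3 jn); rewrite /rates /=; lra.
have [l23|l32] := leP v2 l3; last by rewrite /C3; lra.
have [c0|c0] := posnP (c j fl23).
  have bK : u j <= (1 + 2 * K) / b23.
    rewrite ler_pdivlMr // mulrC; move: (count_ge j fl23 jn).
    by rewrite c0 /rates /=; lra.
  have := ler_wpM2l (ltW l3_gt0) bK.
  have : 0 <= v2 * u j by rewrite mulr_ge0 // ltW.
  by rewrite /C3; lra.
have [i [ij lt bK]] := last_message_gap j fl23 jn b23_gt0 c0.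
have {}bK : u j - u i <= (1 + 2 * K) / b23 := bK.
have [m [im mj]] := x3_le_x2 i j ij lt.
rewrite -(ler_int R) !(rmorphD, rmorphB) /= -!pmulrn.
have mN := leq_trans mj jn.
have umj : u m <= u j by rewrite u_le // mj.
have uim : u i <= u m by rewrite u_le // im.
have : l3 * (u j - u m) <= l3 * ((1 + 2 * K) / b23).
  by apply: (ler_wpM2l (ltW l3_gt0)); move: bK; lra.
have := ler_wpM2l (ltW v20) umj.
move: (count_ge m fl3 mN) (count_leK j fl3 jn) (x2_fluid m mN).
rewrite ler_norml -/v2 /rates /= => ? ? /andP[_ +].
by rewrite /C3; lra.
Qed.

End Fluid.
End Bounds.

(** * Event counts as functions of time *)

Section Timing.
Context {R : realType} (tau : 'I_5 -> nat -> R) (s0 : cstate).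
Hypothesis tau_ge0 : forall k n, 0 <= tau k n.
Local Notation c j := (sim tau s0 j).1.
Local Notation etime := (etime tau s0).
Local Notation flow j := (next_flow tau (c j)).

Lemma arrival_ge0 k n : 0 <= \sum_(i < n) tau k i.
Proof. by apply: sumr_ge0 => i _. Qed.

Lemma arrival_le k m n : (m <= n)%N ->
  \sum_(i < m) tau k i <= \sum_(i < n) tau k i.
Proof.
move=> /subnKC <-; rewrite big_split_ord /= lerDl.
by apply: sumr_ge0 => i _.
Qed.

Lemma etime_le j k : etime j <= pt tau k (c j k).
Proof.
by rewrite /Defs.etime /next_flow; case: arg_minP => // i _ /(_ k isT).
Qed.

(** The time at [i] is a minimum over the flows, hence at most the next point of the flow processed
    at [j], whose count can only grow from [i] to [j]. *)
Lemma etime_mono i j : (i <= j)%N -> etime i <= etime j.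
Proof.
move=> ij; apply: le_trans (etime_le i (flow j)) _.
by rewrite /Defs.etime /pt arrival_le // ltnS count_le.
Qed.

Lemma processed_time j k m : c j k = m.+1 ->
  exists i, (i < j)%N /\ etime i = pt tau k m.
Proof.
elim: j => [//|j IH] /=; rewrite /bumpc.
case: ifP => [/eqP kE [cm]|_ /IH[i [ij iE]]].
  by exists j; split => //; rewrite /Defs.etime -kE cm.
by exists i; split => //; exact: ltnW.
Qed.

Lemma sum_count j : (\sum_k c j k)%N = j.
Proof.
elim: j => [|j IH]; first by rewrite big1.
transitivity (\sum_k c j k)%N.+1; last by rewrite IH.
rewrite [LHS](bigD1 (flow j)) // [in RHS](bigD1 (flow j)) //=.
rewrite /bumpc eqxx addSn; congr (_ + _).+1%N.
by apply: eq_bigr => k /negbTE ->.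
Qed.

Lemma count_lt N t j : (forall i, (i < j)%N -> etime i <= t) ->
  (forall k, t < \sum_(i < N) tau k i) -> 0 <= t -> forall k, (c j k < N)%N.
Proof.
move=> etime_t N_t t0 k; rewrite ltnNge; apply/negP => Nc.
case cE : (c j k) => [|m].
  move: Nc; rewrite cE leqn0 => /eqP N0.
  by have := N_t k; rewrite N0 big_ord0; lra.
have [i [ij iE]] := processed_time j k m cE.
have := etime_t i ij; rewrite iE leNgt => /negP; apply.
by apply: lt_le_trans (N_t k) _; apply: arrival_le; rewrite -cE.
Qed.

(** Pigeonhole: if all events stayed within time [t], each of the five flows would have fewer than
    [N] processed points after [5 * N] events. This excludes the default branch of [nevents]. *)
Lemma etime_unbounded N t : 0 <= t -> (forall k, t < \sum_(i < N) tau k i) ->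
  exists j, t < etime j.
Proof.
move=> t0 N_t; apply: contrapT => no.
have et i : etime i <= t.
  by rewrite leNgt; apply/negP => lt; apply: no; exists i.
have := sum_count (5 * N)%N; apply/eqP; rewrite neq_ltn; apply/orP; left.
have cN k : (c (5 * N) k < N)%N by apply: count_lt => // i _.
have N0 : (0 < N)%N by apply: leq_ltn_trans (cN fl1).
rewrite (@leq_ltn_trans (\sum_(k < 5) N.-1)%N) //.
  by apply: leq_sum => k _; move: (cN k); lia.
by rewrite sum_nat_const card_ord; lia.
Qed.

Lemma neventsP N t : 0 <= t -> (forall k, t < \sum_(i < N) tau k i) ->
  t < etime (nevents tau s0 t) /\
  forall j, (j < nevents tau s0 t)%N -> etime j <= t.
Proof.
move=> t0 N_t; rewrite /nevents; case: pselect => [h|]; last first.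
  by move=> no; case: (no (etime_unbounded N t t0 N_t)).
case: ex_minnP => m tm mmin; split => // j jm.
by rewrite leNgt; apply/negP => /mmin; rewrite leqNgt jm.
Qed.

(** State [j] lasts until its next event, so [u j] lies between the last processed and the first
    unprocessed point of every flow, which costs one unit in the count. The final state is read at
    [t] itself instead of at its next event. *)
Lemma count_at_time N t (r : 'I_5 -> R) e :
  0 <= t -> (forall k, 0 < r k) -> (forall k, t < \sum_(i < N) tau k i) ->
  (forall k m, (m <= N)%N -> `|\sum_(i < m) tau k i - m%:R / r k| <= e) ->
  let n := nevents tau s0 t in
  let u j := if (j < n)%N then etime j else t in
  [/\ forall j, 0 <= u j,
      forall i j, (i <= j <= n)%N -> u i <= u j &
      forall j k, (j <= n)%N -> `|(c j k)%:R - r k * u j| <= 1 + r k * e].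
Proof.
move=> t0 r0 N_t near n u; have [tn et] := neventsP N t t0 N_t.
have et0 j : 0 <= etime j by exact: arrival_ge0.
split.
- by move=> j; rewrite /u; case: ifP.
- move=> i j /andP[ij jn]; rewrite /u; case: (ltnP j n) => jn'.
    by rewrite (leq_ltn_trans ij jn') etime_mono.
  by case: ifP => // iN; exact: et.
move=> j k jn.
(* Strict, so that [near] applies both to the count and to its successor. *)
have cN : (c j k < N)%N.
  by apply: (count_lt N t) => // i ij; apply: et; exact: leq_trans jn.
have uj_ub : u j <= \sum_(i < (c j k).+1) tau k i.
  rewrite /u; case: ifP => jn'; first exact: etime_le.
  have -> : j = n by apply/eqP; rewrite eqn_leq jn leqNgt jn'.
  by apply: le_trans (ltW tn) _; exact: etime_le.
have uj_lb : \sum_(i < c j k) tau k i <= u j.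
  case cE : (c j k) => [|m].
    by rewrite big_ord0 /u; case: ifP.
  have [i [ij iE]] := processed_time j k m cE.
  rewrite -[leLHS]/(pt tau k m) -iE /u; case: ifP => jn'.
    by rewrite etime_mono // ltnW.
  by apply: et; exact: leq_trans jn.
have rk := r0 k.
have := near k (c j k) (ltnW cN); have := near k (c j k).+1 cN.
rewrite !ler_norml => /andP[_ A] /andP[B _].
have {A uj_ub} : r k * (u j - (c j k).+1%:R / r k) <= r k * e.
  by apply: (ler_wpM2l (ltW rk)); move: A uj_ub; lra.
have {B uj_lb} : r k * ((c j k)%:R / r k - u j) <= r k * e.
  by apply: (ler_wpM2l (ltW rk)); move: B uj_lb; lra.
rewrite !mulrBr ![_ * (_ / r k)]mulrC !divfK ?gt_eqF // -natr1 => A B.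
by apply/andP; split; lra.
Qed.
End Timing.

(** * Measurability of the state *)

(* The state after [j] events is a function of the list of flows that produced
   them, so that its measurability reduces to countably many cases. *)
Section History.
Context {R : realType}.

Fixpoint history (tau : 'I_5 -> nat -> R) (s0 : cstate) (j : nat) : seq 'I_5 :=
  if j is j'.+1 then next_flow tau (sim tau s0 j').1 :: history tau s0 j'
  else [::].

Fixpoint replay (s0 : cstate) (h : seq 'I_5) : ('I_5 -> nat) * cstate :=
  if h is k :: h' then
    let cs := replay s0 h' in (bumpc cs.1 k, apply_event k cs.2)
  else (fun=> 0%N, s0).

Lemma sim_replay tau s0 j : sim tau s0 j = replay s0 (history tau s0 j).
Proof. by elim: j => //= j <-. Qed.

(** All flows attaining the earliest unprocessed point. Working with this set, which has finitely
    many possible values, handles ties without knowing which minimizer [next_flow] picks. *)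
Definition first_flows (tau : 'I_5 -> nat -> R) (c : 'I_5 -> nat)
    : {set 'I_5} :=
  [set i | [forall k, pt tau i (c i) <= pt tau k (c k)]].

Lemma next_flowE tau c :
  next_flow tau c = odflt ord0 [pick i in first_flows tau c].
Proof.
by congr odflt; apply: eq_pick => i; rewrite !inE; apply: eq_forallb => k.
Qed.

End History.

Lemma measurable_countable_case {d} {T : measurableType d} {X : countType}
    (f : T -> X) (A : X -> set T) :
  (forall x, measurable [set w | f w = x]) -> (forall x, measurable (A x)) ->
  measurable [set w | A (f w) w].
Proof.
move=> mf mA.
rewrite (_ : [set w | A (f w) w] = \bigcup_x ([set w | f w = x] `&` A x)).
  by apply: countable_bigcupT_measurable => // x; exact: measurableI.
by apply/seteqP; split => [w Aw|w [x _ [/= ->]]//]; exists (f w).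
Qed.

Lemma measurable_gt {d} {T : measurableType d} {R : realType}
    (f : T -> R) (t : R) :
  measurable_fun setT f -> measurable [set w | t < f w].
Proof.
move=> mf; rewrite (_ : [set w | _] = ~` (setT `&` [set w | f w <= t])).
  by apply: measurableC; apply: measurable_fun_le.
by rewrite setTI; apply/seteqP; split => w /=; rewrite ltNge => /negP.
Qed.

Section Measurability.
Context {d : measure_display} {T : measurableType d} {R : realType}.
Variables (tau : 'I_5 -> nat -> T -> R) (s0 : cstate).
Hypothesis mtau : forall k n, measurable_fun setT (tau k n).
Local Notation path w := (fun k n => tau k n w).

Lemma measurable_arrival k n :
  measurable_fun setT (fun w => \sum_(i < n) tau k i w).
Proof. by apply: measurable_sum => i; exact: mtau. Qed.

Let le_pt i k c := [set w | pt (path w) i (c i) <= pt (path w) k (c k)].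

Let measurable_le_pt i k c : measurable (le_pt i k c).
Proof.
rewrite -[le_pt _ _ _]setTI.
by apply: measurable_fun_le => //; exact: measurable_arrival.
Qed.

Let first_flows_in i c : 
  [set w | i \in first_flows (path w) c] = \bigcap_k le_pt i k c.
Proof.
apply/seteqP; split => w /=; rewrite inE.
  by move=> /forallP le k _; exact: le.
by move=> le; apply/forallP => k; exact: le.
Qed.

Lemma measurable_next_flow c k : measurable [set w | next_flow (path w) c = k].
Proof.
pose A (B : {set 'I_5}) :=
  if odflt ord0 [pick i in B] == k then [set: T] else set0.
rewrite (_ : [set w | _] = [set w | A (first_flows (path w) c) w]); last first.
  apply/seteqP; split => w /=; rewrite next_flowE /A.
    by move=> ->; rewrite eqxx.
  by case: ifP => // /eqP.
apply: measurable_countable_case => B; last by rewrite /A; case: ifP.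
have mF i : measurable [set w | i \in first_flows (path w) c].
  by rewrite first_flows_in; apply: fin_bigcap_measurable.
rewrite (_ : [set w | _] = \bigcap_i
    (if i \in B then [set w | i \in first_flows (path w) c]
     else ~` [set w | i \in first_flows (path w) c])).
  apply: fin_bigcap_measurable => // i _; case: ifP => // _; exact: measurableC.
apply/seteqP; split => w /=.
  by move=> BE i _; rewrite -BE; case: ifP => //= /negbT/negP.
move=> H; apply/setP => i; have := H i I.
by case: ifP => //= _ /negP/negbTE.
Qed.

Lemma measurable_history j h : measurable [set w | history (path w) s0 j = h].
Proof.
elim: j h => [|j IH] [|k h] /=.
- by rewrite (_ : [set w | _] = setT) //; apply/seteqP; split.
- by rewrite (_ : [set w | _] = set0) //; apply/seteqP; split.
- by rewrite (_ : [set w | _] = set0) //; apply/seteqP; split.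
rewrite (_ : [set w | _] = [set w | history (path w) s0 j = h] `&`
    [set w | next_flow (path w) (replay s0 h).1 = k]).
  by apply: measurableI => //; exact: measurable_next_flow.
apply/seteqP; split => w /=; rewrite sim_replay; first by case=> <- <-.
by case=> <- <-.
Qed.

Lemma measurable_etime t j : measurable [set w | t < etime (path w) s0 j].
Proof.
rewrite /etime.
pose A h k := [set w | t < pt (path w) k ((replay s0 h).1 k)].
(* The outer point [w] fixes the history while [w'] stays free, so that the countable case analysis
   can be applied twice. *)
rewrite (_ : [set w | _] = [set w |
  [set w' | A (history (path w) s0 j)
    (next_flow (path w') (replay s0 (history (path w) s0 j)).1) w'] w]);
  last first.
  by apply/seteqP; split => w /=; rewrite sim_replay.
apply: (measurable_countable_case (fun w => history (path w) s0 j)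
  (fun h => [set w' | A h (next_flow (path w') (replay s0 h).1) w'])) => [h|h].
  exact: measurable_history.
apply: measurable_countable_case => k; first exact: measurable_next_flow.
exact/measurable_gt/measurable_arrival.
Qed.

Lemma measurable_nevents t n : measurable [set w | nevents (path w) s0 t = n].
Proof.
have mlt j := measurable_etime t j.
(* On [never] the count takes its default value 0, so this set joins the case [n = 0]. *)
pose never := \bigcap_j ~` [set w | t < etime (path w) s0 j].
have mnever : measurable never.
  by apply: bigcapT_measurable => j; exact: measurableC.
rewrite (_ : [set w | _] =
    (if n == 0%N then never else set0) `|`
    ([set w | t < etime (path w) s0 n] `&`
     \bigcap_(j in `I_n) ~` [set w | t < etime (path w) s0 j])).
  apply: measurableU; first by case: ifP.
  apply: measurableI => //.
  by apply: fin_bigcap_measurable => // j _; exact: measurableC.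
apply/seteqP; split => w /=; rewrite /nevents.
  case: pselect => [h|no] /=.
    case: ex_minnP => m tm mmin <-; right; split => // j /= jm tj.
    by have := mmin j tj; rewrite leqNgt jm.
  by move=> <-; left => j _ /= tj; apply: no; exists j.
case: pselect => [h|no] /= [|[]].
- by case: eqP => // _ H; case: h => j tj; case: (H j I).
- move=> tn H; case: ex_minnP => m tm mmin.
  apply/eqP; rewrite eqn_leq mmin //= leqNgt; apply/negP => mn.
  exact: (H m mn).
- by case: eqP.
- by move=> tn; case: no; exists n.
Qed.

Lemma measurable_state_at t (Q : set cstate) :
  measurable [set w | Q (state_at (path w) s0 t)].
Proof.
rewrite /state_at.
apply: (measurable_countable_case (fun w => nevents (path w) s0 t)
  (fun n => [set w | Q (sim (path w) s0 n).2])) => n.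
  exact: measurable_nevents.
pose A h := [set w : T | Q (replay s0 h).2].
rewrite (_ : [set w | _] = [set w | A (history (path w) s0 n) w]); last first.
  by apply/seteqP; split => w /=; rewrite sim_replay.
apply: measurable_countable_case => h; first exact: measurable_history.
have [q|nq] := pselect (Q (replay s0 h).2).
  by rewrite (_ : A h = setT) //; apply/seteqP; split.
by rewrite (_ : A h = set0) //; apply/seteqP; split.
Qed.

End Measurability.

(** * Moments of the exponential distribution *)

Section Integrals.
Context {R : realType}.
Local Notation mu := (@lebesgue_measure R).

Lemma integral_expR_decay (l : R) : 0 < l ->
  (\int[mu]_(x in `[0%R, +oo[) (expR (- (l * x)))%:E = (l^-1)%:E)%E.
Proof.
move=> l0; pose F x := - l^-1 * expR (- l * x).
have cE : continuous (fun x : R => expR (- l * x)).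
  move=> z; apply: continuous_comp; last exact: continuous_expR.
  by apply: continuousM => //; exact: cst_continuous.
have dF (x : R) : is_derive x 1 F (expR (- (l * x))).
  rewrite /F; apply: is_derive_eq.
  rewrite -mulNr /GRing.scale /=; move: (expR _) => e.
  by field; rewrite gt_eqF.
rewrite (@ge0_continuous_FTC2y _ (fun x : R => expR (- (l * x))) F _ 0) //.
- by rewrite /F mulr0 expR0 mulr1 sub0e -EFinN opprK.
- apply: continuous_subspaceT => x.
  rewrite (_ : (fun _ => _) = (fun x : R => expR (- l * x))); first exact: cE.
  by apply/funext => y; rewrite mulNr.
- rewrite -[X in _ --> X](mulr0 (- l^-1)); apply: cvgMr.
  rewrite (_ : (fun x => expR (- l * x)) =
               (fun z => expR (- z)) \o (fun z => l * z)); last first.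
    by apply/funext => x /=; rewrite mulNr.
  apply: (@cvg_comp _ _ _ _ _ _ (pinfty_nbhs R)); last exact: cvgr_expR.
  exact: gt0_cvgMry.
- by apply: cvg_at_right_filter; apply: cvgMr; exact: cE.
- by move=> x _; rewrite derive1E; exact: derive_val.
Qed.

Lemma within_continuous_inv_sqr (C : R) :
  {within `[0%R, +oo[, continuous (fun x : R => C * ((1 + x) ^+ 2)^-1)}.
Proof.
apply: continuous_in_subspaceT => x; rewrite inE /= in_itv /= andbT => x0.
apply: cvgMr; apply: cvgV; first by rewrite gt_eqF // exprn_gt0 //; lra.
apply: (@continuous_comp _ _ _ (fun x : R => 1 + x) (fun y : R => y ^+ 2)).
  by apply: continuousD; [exact: cst_continuous|].
exact: exprn_continuous.
Qed.

Lemma integral_inv_sqr (C : R) : 0 <= C ->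
  (\int[mu]_(x in `[0%R, +oo[) (C * ((1 + x) ^+ 2)^-1)%:E = C%:E)%E.
Proof.
move=> C0; pose F (x : R) := - C * (1 + x)^-1.
have cV (x : R) : 0 <= x -> {for x, continuous (fun x : R => (1 + x)^-1)}.
  move=> x0; apply: continuousV; first by rewrite gt_eqF //; lra.
  by apply: continuousD; [exact: cst_continuous|].
have dF (x : R) : 0 < x -> is_derive x 1 F (C * ((1 + x) ^+ 2)^-1).
  move=> x0; have x1 : 1 + x != 0 by rewrite gt_eqF //; lra.
  rewrite /F; apply: is_derive_eq.
  by rewrite /GRing.scale /=; field.
rewrite (@ge0_continuous_FTC2y _ (fun x : R => C * ((1 + x) ^+ 2)^-1) F _ 0) //.
- by rewrite /F addr0 invr1 mulr1 sub0e -EFinN opprK.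
- by move=> x x0; rewrite mulr_ge0 // invr_ge0 sqr_ge0.
- exact: within_continuous_inv_sqr.
- rewrite -[X in _ --> X](mulr0 (- C)); apply: cvgMr.
  apply/gtr0_cvgV0.
    by near=> x; rewrite addr_gt0 //; near: x; exact: nbhs_pinfty_gt.
  apply/cvgryPge => A; near=> x.
  rewrite (@le_trans _ _ x) ?lerDr //; near: x; exact: nbhs_pinfty_ge.
- by move=> x x0; have := dF x x0 => -[].
- by apply: cvg_at_right_filter; apply: cvgMr; exact: cV.
- move=> x; rewrite in_itv /= andbT => x0; rewrite derive1E.
  by have := dF x x0 => d; exact: derive_val.
Unshelve. all: by end_near. Qed.
End Integrals.

Section ExponentialMoments.
Local Open Scope ereal_scope.
Context {d : measure_display} {T : measurableType d} {R : realType}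
  (P : probability T R).
Local Notation mu := (@lebesgue_measure R).

Lemma expectation_tail (X : T -> R) : measurable_fun setT X ->
  (forall w, 0 <= X w)%R ->
  'E_P[X] = \int[mu]_(r in `[0%R, +oo[) P [set w | (r < X w)%R].
Proof.
move=> mX X0; pose Y : {RV P >-> R} := mfun_Sub (mem_set mX : X \in mfun).
rewrite -[X]/(Y : T -> R) ge0_expectation_ccdf //.
apply: eq_integral => r _; rewrite /ccdf /distribution /pushforward /=.
by congr (P _); apply/seteqP; split => w /=; rewrite in_itv /= andbT.
Qed.

Lemma measurable_tail (X : T -> R) : measurable_fun setT X ->
  measurable_fun setT (fun r : R => P [set w | (r < X w)%R]).
Proof.
move=> mX; pose Y : {RV P >-> R} := mfun_Sub (mem_set mX : X \in mfun).
rewrite (_ : (fun r => _) = ccdf Y); first exact: ccdf_measurable.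
apply/funext => r; rewrite /ccdf /distribution /pushforward /=.
by congr (P _); apply/seteqP; split => w /=; rewrite in_itv /= andbT.
Qed.

Variables (X : T -> R) (l : R).
Hypotheses (l_gt0 : (0 < l)%R) (mX : measurable_fun setT X).
Hypotheses (X_ge0 : forall w, (0 <= X w)%R).
Hypothesis X_tail : forall s, (0 <= s)%R ->
  P [set w | (s < X w)%R] = (expR (- (l * s)))%:E.

Lemma exponential_mean : 'E_P[X] = (l^-1)%:E.
Proof.
rewrite expectation_tail // -integral_expR_decay //.
apply: eq_integral => r; rewrite inE /= in_itv /= andbT => r0.
exact: X_tail.
Qed.

(** Any finite bound would do; the exact second moment is [2 / l ^+ 2]. This constant C satisfies (1
    + r)^2 <= 2 (1 + r^2) <= C (1 + l^4 r^2 / 24), where the last factor is a lower bound of exp (l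
    sqrt r), and C is also the integral of C (1 + r)^-2. *)
Definition second_moment_bound : R := 2 * (1 + 24 / l ^+ 4).

Lemma second_moment_bound_ge0 : (0 <= second_moment_bound)%R.
Proof.
rewrite /second_moment_bound mulr_ge0 // addr_ge0 // divr_ge0 //.
by rewrite exprn_ge0 // ltW.
Qed.

(* [e^y >= 1 + y^4/24] bounds the tail [exp (- l sqrt r)] of [X^2] by a
   multiple of [(1 + r)^-2]. *)
Lemma exponential_second_moment :
  'E_P[fun w => X w ^+ 2]%R <= second_moment_bound%:E.
Proof.
have C0 := second_moment_bound_ge0.
rewrite expectation_tail; [|exact: measurable_funX|by move=> w; exact: sqr_ge0].
rewrite -[leRHS]integral_inv_sqr //.
have sE (r : R) : (0 <= r)%R ->
    [set w | (r < X w ^+ 2)%R] = [set w | (Num.sqrt r < X w)%R].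
  move=> r0; apply/funext => w /=; rewrite -[in (r < _)%R](sqr_sqrtr r0).
  by rewrite ltr_pXn2r ?nnegrE ?sqrtr_ge0.
apply: ge0_le_integral => //.
- by apply: measurable_funTS; apply: measurable_tail; exact: measurable_funX.
- apply/measurable_EFinP; apply: subspace_continuous_measurable_fun => //.
  exact: within_continuous_inv_sqr.
move=> r; rewrite /= in_itv /= andbT => r0.
rewrite sE // X_tail ?sqrtr_ge0 // lee_fin.
have y0 : (0 <= l * Num.sqrt r)%R by rewrite mulr_ge0 ?sqrtr_ge0 // ltW.
have := expR_ge1Dxn 3 y0.
rewrite exprMn (_ : Num.sqrt r ^+ 4 = r ^+ 2)%R; last first.
  by rewrite -[4%N]/(2 * 2)%N exprM sqr_sqrtr.
move=> He; rewrite ler_pdivlMr ?exprn_gt0 //; last by lra.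
rewrite expRN [leLHS]mulrC ler_pdivrMr ?expR_gt0 //.
apply: (@le_trans _ _
  (second_moment_bound * (1 + l ^+ 4 * r ^+ 2 / 4`!%:R))%R); last first.
  exact: ler_wpM2l.
have l40 : (0 < l ^+ 4)%R by rewrite exprn_gt0.
rewrite /second_moment_bound (_ : 4`!%:R = 24 :> R)%R //.
have -> : (2 * (1 + 24 / l ^+ 4) * (1 + l ^+ 4 * r ^+ 2 / 24)
  = 2 * (1 + r ^+ 2) + 2 * (24 / l ^+ 4) + l ^+ 4 * r ^+ 2 / 12)%R.
  by field; rewrite gt_eqF.
have : (0 <= 24 / l ^+ 4)%R by rewrite divr_ge0 // ltW.
have : (0 <= l ^+ 4 * r ^+ 2 / 12)%R.
  by rewrite divr_ge0 // mulr_ge0 ?sqr_ge0 // ltW.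
have := sqr_ge0 (1 - r)%R.
by nra.
Qed.

Lemma exponential_Lfun2 : X \in Lfun P 2%:E.
Proof.
apply/andP; split; rewrite inE //= /finite_norm unlock.
apply: poweR_lty.
apply: (@le_lt_trans _ _ second_moment_bound%:E); last exact: ltry.
apply: le_trans exponential_second_moment; rewrite unlock.
rewrite (eq_integral (fun w => (X w ^+ 2)%:E)) // => w _ /=.
by rewrite powR_mulrn // ger0_norm.
Qed.

Lemma exponential_variance : 'V_P[X] <= second_moment_bound%:E.
Proof.
rewrite varianceE ?exponential_Lfun2 //.
apply: le_trans exponential_second_moment.
rewrite leeBlDr; last by rewrite exponential_mean.
by rewrite leeDl // sqre_ge0.
Qed.

End ExponentialMoments.

(** * Independence and expectation of products *)

Definition indep2 {d} {T : measurableType d} {R : realType}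
    (P : probability T R) (X Y : T -> R) :=
  forall A B : set R, measurable A -> measurable B ->
  P (X @^-1` A `&` Y @^-1` B) = (P (X @^-1` A) * P (Y @^-1` B))%E.

Section Independence.
Local Open Scope ereal_scope.
Context {d : measure_display} {T : measurableType d} {R : realType}
  (P : probability T R).

(** The joint law agrees with the product of the laws on rectangles, hence everywhere, and Tonelli
    splits the integral. Absolute values make the integrands nonnegative on the whole line, where
    the laws live. *)
Lemma expectation_mul_indep (X Y : T -> R) :
  measurable_fun setT X -> measurable_fun setT Y ->
  (forall w, 0 <= X w)%R -> (forall w, 0 <= Y w)%R -> indep2 P X Y ->
  'E_P[X * Y] = 'E_P[X] * 'E_P[Y].
Proof.
move=> mX mY X0 Y0 XY.
have mZ := measurable_fun_pair mX mY.
pose X' : {RV P >-> R} := mfun_Sub (mem_set mX : X \in mfun).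
pose Y' : {RV P >-> R} := mfun_Sub (mem_set mY : Y \in mfun).
pose Z' : {RV P >-> (R * R)%type} :=
  mfun_Sub (mem_set mZ : (fun w => (X w, Y w)) \in mfun).
have mnorm : measurable_fun [set: R] (fun x : R => `|x|%:E).
  by apply/measurable_EFinP.
have EX (U : {RV P >-> R}) : (forall w, 0 <= U w)%R ->
    'E_P[U] = \int[distribution P U]_x `|x|%:E.
  move=> U0; rewrite ge0_integral_distribution // unlock.
  by apply: eq_integral => w _ /=; rewrite ger0_norm.
rewrite -[X in RHS]/(X' : T -> R) (EX X') //.
rewrite -[Y in RHS]/(Y' : T -> R) (EX Y') //.
pose f (z : R * R) := `|z.1|%:E * `|z.2|%:E.
have f0 z : 0 <= f z by rewrite /f mule_ge0 ?lee_fin.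
have mf : measurable_fun setT f.
  by apply: emeasurable_funM;
    [exact: (measurableT_comp mnorm measurable_fst)
    |exact: (measurableT_comp mnorm measurable_snd)].
transitivity (\int[distribution P Z']_z f z).
  rewrite ge0_integral_distribution // unlock; apply: eq_integral => w _ /=.
  by rewrite /f /= !ger0_norm.
have -> : \int[distribution P Z']_z f z =
    \int[(distribution P X' \x distribution P Y')%E]_z f z.
  apply/esym/eq_measure_integral => A mA _; exact: product_measure_unique.
rewrite fubini_tonelli1 //.
under eq_integral => x _.
  rewrite /fubini_F /f /= ge0_integralZl_EFin //.
  over.
rewrite ge0_integralZr //.
by apply: integral_ge0.
Qed.
End Independence.

(** * Uniform weak law of large numbers *)

Section WeakLaw.
Local Open Scope ereal_scope.
Context {d : measure_display} {T : measurableType d} {R : realType}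
  (P : probability T R).
Variables (X : nat -> T -> R) (l : R).
Hypotheses (l_gt0 : (0 < l)%R) (mX : forall n, measurable_fun setT (X n)).
Hypotheses (X_ge0 : forall n w, (0 <= X n w)%R).
Hypothesis X_tail : forall n s, (0 <= s)%R ->
  P [set w | (s < X n w)%R] = (expR (- (l * s)))%:E.
Hypothesis X_indep : forall m n, m != n -> indep2 P (X m) (X n).

Let S n w : R := (\sum_(i < n) X i w)%R.
Let C := second_moment_bound l.

Let SS n : S n.+1 = (S n \+ X n)%R.
Proof. by apply/funext => w; rewrite /S big_ord_recr. Qed.

Let S0 : S 0 = cst 0%R.
Proof. by apply/funext => w; rewrite /S big_ord0. Qed.

Let X2 n : X n \in Lfun P 2%:E.
Proof. exact: exponential_Lfun2 l_gt0 (mX n) (X_ge0 n) (X_tail n). Qed.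

Let EX n : 'E_P[X n] = (l^-1)%:E.
Proof. exact: exponential_mean l_gt0 (mX n) (X_ge0 n) (X_tail n). Qed.

Let Lfun21 (Y : T -> R) : Y \in Lfun P 2%:E -> Y \in Lfun P 1.
Proof. by apply: Lfun_subset12; exact: fin_num_measure. Qed.

Let S2 n : S n \in Lfun P 2%:E.
Proof.
elim: n => [|n IH]; first by rewrite S0 Lfun_cst.
by rewrite SS rpredD // lee_fin ler1n.
Qed.

Let mS n : measurable_fun setT (S n).
Proof. by apply: measurable_sum. Qed.

Lemma mean_sum n : 'E_P[S n] = (n%:R / l)%:E.
Proof.
elim: n => [|n IH]; first by rewrite S0 expectation_cst mul0r.
rewrite SS expectationD ?Lfun21 // IH EX.
by rewrite -EFinD -natr1 mulrDl mul1r.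
Qed.

Lemma covariance_indep m n : m != n -> covariance P (X m) (X n) = 0.
Proof.
move=> mn; have XY1 : (X m * X n)%R \in Lfun P 1 by exact: Lfun2_mul_Lfun1.
rewrite (covarianceE (Lfun21 _ (X2 m)) (Lfun21 _ (X2 n)) XY1).
rewrite expectation_mul_indep //; last exact: X_indep.
by rewrite subee // !EX.
Qed.

Lemma covariance_sum n m : (n <= m)%N -> covariance P (S n) (X m) = 0.
Proof.
elim: n => [|n IH] nm; first by rewrite S0 covariance_cst_l.
rewrite SS covarianceDl // IH ?(ltnW nm) // covariance_indep ?adde0 //.
by rewrite ltn_eqF.
Qed.

Lemma variance_sum n : 'V_P[S n] <= (n%:R * C)%:E.
Proof.
elim: n => [|n IH]; first by rewrite S0 variance_cst mul0r.
rewrite SS varianceD // covariance_sum // mule0 adde0.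
rewrite -natr1 mulrDl mul1r EFinD leeD //.
exact: exponential_variance l_gt0 (mX n) (X_ge0 n) (X_tail n).
Qed.

Lemma chebyshev_sum n (e : R) : (0 < e)%R ->
  P [set w | (e <= `|S n w - n%:R / l|)%R] <= (e ^- 2 * (n%:R * C))%:E.
Proof.
move=> e0; pose Y : {RV P >-> R} := mfun_Sub (mem_set (mS n) : S n \in mfun).
have := chebyshev Y e0.
rewrite -[Y : T -> R]/(S n) mean_sum /= => /le_trans; apply.
rewrite EFinM lee_wpmul2l ?variance_sum //.
by rewrite lee_fin invr_ge0 exprn_ge0 // ltW.
Qed.

Let far (n : nat) (e : R) := [set w | (e <= `|S n w - n%:R / l|)%R].

Let mfar n e : measurable (far n e).
Proof.
rewrite -[far n e]setTI; apply: measurable_fun_le => //.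
apply: measurableT_comp => //; apply: measurable_funB => //; exact: mS.
Qed.

Definition uniformly_far (N : nat) (e : R) :=
  [set w | exists2 m, (m <= N)%N & (e < `|S m w - m%:R / l|)%R].

Lemma measurable_uniformly_far N e : measurable (uniformly_far N e).
Proof.
rewrite -[uniformly_far N e]/(\bigcup_(m in `I_N.+1)
  [set w | (e < `|S m w - m%:R / l|)%R]).
apply: fin_bigcup_measurable => // m _; apply: measurable_gt.
by apply: measurableT_comp => //; apply: measurable_funB => //; exact: mS.
Qed.

(* Arrival times are monotone, so it is enough to control them on a grid. *)
Lemma uniformly_far_grid N L q e : (0 < q)%N -> (N <= L * q)%N ->
  (q%:R / l <= e)%R ->
  uniformly_far N (e + e)%R `<=` \big[setU/set0]_(i < L.+2) far (i * q) e.
Proof.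
move=> q0 NLq qe w [m mN far_m].
have Smono a b : (a <= b)%N -> (S a w <= S b w)%R.
  move=> /subnKC <-; rewrite /S big_split_ord /= lerDl.
  by apply: sumr_ge0.
have l0 : (0 < l^-1)%R by rewrite invr_gt0.
have im := leq_trunc_div m q; have mi := ltn_ceil m q0.
set i := (m %/ q)%N in im mi.
have iL : (i <= L)%N by rewrite -(mulnK L q0) leq_div2r // (leq_trans mN).
have qE : ((i.+1 * q)%:R / l = (i * q)%:R / l + q%:R / l :> R)%R.
  by rewrite mulSn natrD mulrDl addrC.
have ml1 : ((i * q)%:R / l <= m%:R / l :> R)%R by rewrite ler_pM2r // ler_nat.
have ml2 : (m%:R / l <= (i.+1 * q)%:R / l :> R)%R.
  by rewrite ler_pM2r // ler_nat ltnW.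
have S1 := Smono _ _ im; have S2' := Smono _ _ (ltnW mi).
rewrite -(bigcup_mkord _ (fun i => far (i * q) e)).
(* A sum too small at [m] is too small at the grid point below, and one too large is too large at
   the grid point above. The mean moves by at most [q / l <= e], half of the deviation; the point
   above may be [L.+1], hence [L.+2] grid points. *)
have [neg|pos] := leP (S m w - m%:R / l)%R 0%R.
  move: far_m; rewrite ler0_norm // => far_m.
  exists i; first by rewrite /= ltnS leqW.
  rewrite /far /= ler_normr; apply/orP; right; lra.
move: far_m; rewrite gtr0_norm // => far_m.
exists i.+1; first by rewrite /= !ltnS.
by rewrite /far /= ler_normr; apply/orP; left; lra.
Qed.

Lemma weak_law (e delta : R) : (0 < e)%R -> (0 < delta)%R ->
  exists N0, forall N, (N0 <= N)%N ->
    P (uniformly_far N (e * N%:R)) <= delta%:E.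
Proof.
move=> e0 d0.
have C0 : (0 <= C)%R by exact: second_moment_bound_ge0.
(* The number [L] of grid steps does not depend on [N] and makes the mean [q / l] of one step at
   most [e * N / 2]. Beyond [B], the sum of the [L.+2] Chebyshev bounds, estimated with
   [q <= 2 * N], is at most [delta]. *)
pose L := (Num.truncn (4 / (e * l))).+1.
pose B := (8 * (L.+2%:R ^+ 2 * C) / (e ^+ 2 * delta))%R.
exists (maxn L (Num.truncn B).+1) => N; rewrite geq_max => /andP[LN BN].
have L_lb : (4 / (e * l) <= L%:R)%R by apply: ltW; exact: truncnS_gt.
have N_lb : (B <= N%:R)%R.
  by apply: le_trans (ltW (truncnS_gt B)) _; rewrite ler_nat.
have L0 : (0 < L%:R :> R)%R by rewrite ltr0n.
have N0 : (0 < N%:R :> R)%R by rewrite ltr0n (leq_trans _ LN).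
have eN0 : (0 < e * N%:R / 2)%R by rewrite divr_gt0 // mulr_gt0.
pose q := (N %/ L).+1.
have q_ub : (q%:R <= N%:R / L%:R + 1 :> R)%R.
  rewrite /q -natr1 lerD2r ler_pdivlMr // -natrM ler_nat; exact: leq_trunc_div.
have q_2N : (q%:R <= 2 * N%:R :> R)%R.
  rewrite -natrM ler_nat /q; have := leq_div N L.
  have : (0 < N)%N by move: N0; rewrite ltr0n.
  lia.
have NLq : (N <= L * q)%N by rewrite mulnC ltnW // ltn_ceil.
have qe : (q%:R / l <= e * N%:R / 2)%R.
  rewrite ler_pdivrMr //; apply: le_trans q_ub _.
  have el : (0 < e * l)%R by rewrite mulr_gt0.
  have H1 : (N%:R / L%:R <= N%:R * (e * l / 4))%R.
    rewrite ler_pM2l // invf_ple ?posrE ?divr_gt0 //; first by rewrite invf_div.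
  have H2 : (1 <= N%:R * (e * l / 4))%R.
    rewrite -ler_pdivrMr ?divr_gt0 // div1r invf_div.
    by rewrite (le_trans L_lb) // ler_nat.
  by lra.
rewrite (_ : (e * N%:R)%R = (e * N%:R / 2 + e * N%:R / 2)%R); last first.
  by rewrite -splitr.
have sub := uniformly_far_grid N L q _ (ltn0Sn _) NLq qe.
apply: (@le_trans _ _
  (P (\big[setU/set0]_(i < L.+2) far (i * q) (e * N%:R / 2)))).
  apply: le_measure => //; rewrite inE; first exact: measurable_uniformly_far.
  exact: bigsetU_measurable.
apply: (le_trans (Boole_inequality P
  (A := fun i => far (i * q) (e * N%:R / 2)) _)).
  by [].
pose G := ((e * N%:R / 2) ^- 2 * (L.+2%:R * q%:R * C))%R.
apply: (@le_trans _ _ (\sum_(i < L.+2) G%:E)).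
  apply: lee_sum => i _; apply: le_trans (chebyshev_sum _ _ eN0) _.
  rewrite lee_fin ler_wpM2l ?invr_ge0 ?exprn_ge0 ?(ltW eN0) //.
  by rewrite ler_wpM2r // -natrM ler_nat leq_mul2r ltnW ?orbT.
rewrite sumEFin lee_fin sumr_const card_ord -mulr_natl.
have GE : (L.+2%:R * G = 4 * (L.+2%:R ^+ 2 * C) * q%:R / (e * N%:R) ^+ 2)%R.
  by rewrite /G; field; rewrite !gt_eqF.
rewrite GE ler_pdivrMr ?exprn_gt0 ?mulr_gt0 //.
have H0 : (0 <= 4 * (L.+2%:R ^+ 2 * C))%R.
  by rewrite mulr_ge0 // mulr_ge0 // sqr_ge0.
apply: le_trans (ler_wpM2l H0 q_2N) _.
move: N_lb; rewrite /B ler_pdivrMr ?mulr_gt0 ?exprn_gt0 // => N_lb.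
have := ler_wpM2r (ltW N0) N_lb; lra.
Qed.

End WeakLaw.

(** * Convergence of the speeds *)

Section Cascade.
Context {R : realType} (l1 l2 l3 b12 b23 : R) (a1 a2 a3 : int).
Hypotheses (l1_gt0 : 0 < l1) (l2_gt0 : 0 < l2) (l3_gt0 : 0 < l3).
Hypotheses (b12_gt0 : 0 < b12) (b23_gt0 : 0 < b23).
Let s0 := init_state a1 a2 a3.
Let rate := rates l1 l2 l3 b12 b23.

Definition total_rate := l1 + l2 + l3 + b12 + b23.

Lemma rate_gt0 k : 0 < rate k.
Proof. by elim/flow_ind: k. Qed.

Lemma rate_le k : rate k <= total_rate.
Proof.
rewrite /total_rate; move: l1_gt0 l2_gt0 l3_gt0 b12_gt0 b23_gt0.
by elim/flow_ind: k; rewrite /rate /rates /=; lra.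
Qed.

Lemma total_rate_gt0 : 0 < total_rate.
Proof. exact: lt_le_trans (rate_gt0 ord0) (rate_le ord0). Qed.

Definition close_on (tau : 'I_5 -> nat -> R) (N : nat) (e : R) :=
  forall k m, (m <= N)%N -> `|\sum_(i < m) tau k i - m%:R / rate k| <= e.

(** The error constant of [x3_fluid], expanded in [K], is [alpha + beta * K]; it dominates those for
    [x1] and [x2]. *)
Let alpha : R := `|a1%:~R| + `|a2%:~R| + `|a3%:~R| + l2 / b12 + l3 / b23.
Let beta : R := 6 + 2 * (l2 / b12 + l3 / b23).

Lemma cascade_fluid (tau : 'I_5 -> nat -> R) (t : R) (N : nat) (e : R) :
  (forall k n, 0 <= tau k n) -> 0 <= t -> 0 <= e ->
  (forall k, t < \sum_(i < N) tau k i) -> close_on tau N e ->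
  let s := state_at tau s0 t in
  let C := alpha + beta * (1 + total_rate * e) in
  [/\ `|(cx1 s)%:~R - l1 * t| <= C,
      `|(cx2 s)%:~R - Num.min l1 l2 * t| <= C &
      `|(cx3 s)%:~R - Num.min (Num.min l1 l2) l3 * t| <= C].
Proof.
move=> tau0 t0 e0 N_t close s C.
pose n := nevents tau s0 t.
pose u j := if (j < n)%N then etime tau s0 j else t.
have [u0 umono ucount] : [/\ forall j, 0 <= u j,
    forall i j, (i <= j <= n)%N -> u i <= u j &
    forall j k, (j <= n)%N ->
      `|((sim tau s0 j).1 k)%:R - rate k * u j| <= 1 + rate k * e].
  exact: (count_at_time tau s0 tau0 N t rate e t0 rate_gt0 N_t close).
set K := 1 + total_rate * e.
have near j k : (j <= n)%N -> `|((sim tau s0 j).1 k)%:R - rate k * u j| <= K.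
  move=> jn; apply: le_trans (ucount j k jn) _.
  by rewrite lerD2l ler_wpM2r // rate_le.
have unt : u n = t by rewrite /u ltnn.
have u0' j : (j <= n)%N -> 0 <= u j by move=> _; exact: u0.
have K1 : 1 <= K by rewrite lerDl mulr_ge0 // ltW // total_rate_gt0.
have := x1_fluid tau a1 a2 a3 l1 l2 l3 b12 b23 K u n near n (leqnn n).
have := x2_fluid tau a1 a2 a3 l1 l2 l3 b12 b23 K u n
  l1_gt0 l2_gt0 b12_gt0 u0' umono near n (leqnn n).
have := x3_fluid tau a1 a2 a3 l1 l2 l3 b12 b23 K u n
  l1_gt0 l2_gt0 l3_gt0 b12_gt0 b23_gt0 u0' umono near n (leqnn n).
rewrite unt -/s0 -[(sim tau s0 n).2]/s.
have A1 := normr_ge0 (a1%:~R : R).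
have A2 := normr_ge0 (a2%:~R : R).
have A3 := normr_ge0 (a3%:~R : R).
have q2 : 0 <= l2 / b12 by rewrite divr_ge0 // ltW.
have q3 : 0 <= l3 / b23 by rewrite divr_ge0 // ltW.
have q2K : 0 <= l2 / b12 * K by rewrite mulr_ge0 //; lra.
have q3K : 0 <= l3 / b23 * K by rewrite mulr_ge0 //; lra.
rewrite [l2 * (_ / _)]mulrCA [l3 * (_ / _)]mulrCA.
rewrite /C -/K /alpha /beta => B3 B2 B1; split.
- by apply: le_trans B1 _; lra.
- by apply: le_trans B2 _; lra.
- by apply: le_trans B3 _; lra.
Qed.

(** * From the pathwise bound to convergence in probability *)

Section Convergence.
Context {d : measure_display} {T : measurableType d} (P : probability T R).
Variable tau : 'I_5 -> nat -> T -> R.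
Hypothesis mtau : forall k n, measurable_fun setT (tau k n).
Hypothesis tau_tail : forall k n (s : R), 0 <= s ->
  P [set w | s < tau k n w] = (expR (- (rate k * s)))%:E.
Hypothesis tau_indep :
  mutually_independent P (fun kn : 'I_5 * nat => tau kn.1 kn.2).

(* The inter-arrival times are nonnegative only almost surely. *)
Let X k n w := Num.max (tau k n w) 0.

Let mX k n : measurable_fun setT (X k n).
Proof. by apply: measurable_maxr => //; exact: measurable_cst. Qed.

Let X_ge0 k n w : 0 <= X k n w.
Proof. by rewrite le_max lexx orbT. Qed.

Let X_tail k n (s : R) : 0 <= s ->
  P [set w | s < X k n w] = (expR (- (rate k * s)))%:E.
Proof.
move=> s_ge0; rewrite -(tau_tail k n) //; congr (P _).
by apply/funext => w /=; rewrite lt_max [s < 0]ltNge s_ge0 orbF.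
Qed.

(** Truncation at 0 is a measurable map [g], so independence passes to [X] through preimages under
    [g]. *)
Let X_indep k m n : m != n -> indep2 P (X k m) (X k n).
Proof.
move=> mn A B mA mB; pose g (x : R) := Num.max x 0.
have mg : measurable_fun [set: R] g.
  by apply: measurable_maxr; [exact: measurable_id|exact: measurable_cst].
have mgP D : measurable D -> measurable (g @^-1` D).
  by move=> mD; rewrite -[X in measurable X]setTI; exact: mg.
pose D (kn : 'I_5 * nat) := if kn == (k, m) then g @^-1` A else g @^-1` B.
have nm : ((k, n) == (k, m)) = false.
  by rewrite xpair_eqE eqxx /= eq_sym; exact: negbTE.
have /= := tau_indep [:: (k, m); (k, n)] D.
rewrite inE xpair_eqE eqxx /= mn => /(_ isT).
have mD i : measurable (D i) by rewrite /D; case: ifP => _; exact: mgP.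
move=> /(_ mD); rewrite bigcap_seq !big_cons !big_nil /D /= eqxx nm setIT mule1.
by [].
Qed.

Let nonpos k := \bigcup_n ~` [set w | 0 < tau k n w].

Let mpos k n : measurable (~` [set w | 0 < tau k n w]).
Proof. exact/measurableC/measurable_gt. Qed.

Let mnonpos k : measurable (nonpos k).
Proof. exact: bigcupT_measurable. Qed.

(** The tail at [s = 0] makes each inter-arrival time positive almost surely, and there are
    countably many. *)
Let P_nonpos k : P (nonpos k) = 0%E.
Proof.
apply/eqP; rewrite eq_le measure_ge0 andbT.
apply: (le_trans (generalized_Boole_inequality P (mpos k) (mnonpos k))).
rewrite eseries0 // => n _ _.
transitivity (1 - P [set w | (0 < tau k n w)%R])%E.
  exact/probability_setC/measurable_gt.
by rewrite tau_tail // mulr0 oppr0 expR0 subee.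
Qed.

Let bad N e k := nonpos k `|` uniformly_far (X k) (rate k) N e.

Let mbad N e k : measurable (bad N e k).
Proof. by apply: measurableU => //; exact: measurable_uniformly_far. Qed.

Let Pbad N e : measurable (\big[setU/set0]_(i < 5) bad N e (inord i)).
Proof. exact: bigsetU_measurable. Qed.

Lemma bad_small (e delta : R) : 0 < e -> 0 < delta ->
  exists N0, forall N, (N0 <= N)%N ->
    (P (\big[setU/set0]_(i < 5) bad N (e * N%:R) (inord i)) <= delta%:E)%E.
Proof.
move=> e0 d0.
have d5 : 0 < delta / 5 by rewrite divr_gt0.
have /choice [N0 N0P] : forall k, exists N0, forall N, (N0 <= N)%N ->
    (P (uniformly_far (X k) (rate k) N (e * N%:R)) <= (delta / 5)%:E)%E.
  move=> k; exact: (weak_law P (X k) (rate k) (rate_gt0 k) (mX k) (X_ge0 k)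
    (X_tail k) (X_indep k) e (delta / 5) e0 d5).
exists (\max_k N0 k)%N => N N0N.
apply: (le_trans (Boole_inequality P
  (A := fun i => bad N (e * N%:R) (inord i)) _)).
  by [].
apply: (@le_trans _ _ (\sum_(i < 5) (delta / 5)%:E)%E); last first.
  by rewrite sumEFin lee_fin !big_ord_recr big_ord0 /=; lra.
apply: lee_sum => i _; apply: (@le_trans _ _ (P (nonpos (inord i)) +
    P (uniformly_far (X (inord i)) (rate (inord i)) N (e * N%:R)%R))%E).
  by apply: measureU2 => //; exact: measurable_uniformly_far.
rewrite P_nonpos add0e; apply: N0P; apply: leq_trans N0N.
exact: leq_bigmax.
Qed.

Lemma speed_cvg (proj : cstate -> int) (v : R) :
  (forall (p : 'I_5 -> nat -> R) (t : R) (N : nat) (e : R),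
    (forall k n, 0 <= p k n) -> 0 <= t -> 0 <= e ->
    (forall k, t < \sum_(i < N) p k i) -> close_on p N e ->
    `|(proj (state_at p s0 t))%:~R - v * t| <=
      alpha + beta * (1 + total_rate * e)) ->
  cvg_in_prob P (speed tau s0 proj) v.
Proof.
move=> fluid eps delta eps0 delta0.
have rs0 := total_rate_gt0; set rs := total_rate in fluid rs0.
have q2 : 0 <= l2 / b12 by rewrite divr_ge0 // ltW.
have q3 : 0 <= l3 / b23 by rewrite divr_ge0 // ltW.
have beta0 : 0 < beta by rewrite /beta; lra.
have alpha0 : 0 <= alpha.
  rewrite /alpha; move: (normr_ge0 (a1%:~R : R)) (normr_ge0 (a2%:~R : R)).
  by move: (normr_ge0 (a3%:~R : R)); lra.
(* With N about 2 rs t, the first bound puts the [N]-th arrival of every flow after [t], as it is at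
   least N / rs - eta N >= N / (2 rs). The second keeps the growing part of the error, beta rs eta
   N, within eps t / 2 up to a constant. *)
pose eta := Num.min (1 / (2 * rs)) (eps / (4 * beta * rs ^+ 2)).
have eta0 : 0 < eta.
  by rewrite lt_min !divr_gt0 // ?mulr_gt0 // exprn_gt0.
have eta1 : eta * (2 * rs) <= 1.
  by rewrite -ler_pdivlMr ?mulr_gt0 // ge_min lexx.
have eta2 : eta * (4 * beta * rs ^+ 2) <= eps.
  by rewrite -ler_pdivlMr ?mulr_gt0 ?exprn_gt0 // ge_min lexx orbT.
have [N0 N0P] := bad_small eta delta eta0 delta0.
(* The first term ensures [N0 <= N]; the second absorbs the bounded part of the error, at most
   [alpha + 2 * beta], into the other half of [eps * t]. *)
exists (N0%:R / (2 * rs) + 2 * (alpha + 2 * beta) / eps) => t tM.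
have c1 : 0 <= N0%:R / (2 * rs) by rewrite divr_ge0 // ltW // mulr_gt0.
have c2 : 0 < 2 * (alpha + 2 * beta) / eps by rewrite divr_gt0 //; lra.
have t0 : 0 < t by lra.
have rst0 : 0 <= 2 * rs * t by rewrite !mulr_ge0 // ltW.
pose N := (Num.truncn (2 * rs * t)).+1.
have N_lb : 2 * rs * t < N%:R by exact: truncnS_gt.
have N_ub : N%:R <= 2 * rs * t + 1 by rewrite /N -natr1 lerD2r truncn_le.
have N0N : (N0 <= N)%N.
  rewrite -(ler_nat R); apply: le_trans (ltW N_lb).
  by rewrite mulrC -ler_pdivrMr ?mulr_gt0 //; lra.
apply: le_trans (N0P N N0N); apply: le_measure; rewrite ?inE //.
  apply: (@measurable_state_at _ _ _ tau s0 mtau t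
    [set s | eps < `|(proj s)%:~R / t - v|]).
(* Outside the bad event the pathwise bound applies with [e := eta * N]. *)
move=> w /=; apply: contraPP => good.
have goodk k : ~ bad N (eta * N%:R) k w.
  move=> bk; apply: good.
  rewrite -(bigcup_mkord _ (fun i => bad N (eta * N%:R) (inord i))).
  by exists k => //=; rewrite inord_val.
have pos k n : 0 < tau k n w.
  by apply: contrapT => np; apply: (goodk k); left; exists n.
have XE k n : X k n w = tau k n w by rewrite /X; apply/max_idPl/ltW.
have close : close_on (fun k n => tau k n w) N (eta * N%:R).
  move=> k m mN; rewrite leNgt; apply/negP => farm; apply: (goodk k); right.
  by exists m => //; under eq_bigr do rewrite XE.
have N_t k : t < \sum_(i < N) tau k i w.
  have := close k N (leqnn N); rewrite ler_norml => /andP[lb _].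
  have rk := rate_gt0 k.
  have H : N%:R / rs <= N%:R / rate k.
    by rewrite ler_pM2l ?lef_pV2 ?posrE ?ltr0n // rate_le.
  have H1 : eta * N%:R <= N%:R / rs / 2.
    rewrite ler_pdivlMr // ler_pdivlMr //.
    have := ler_wpM2r (ler0n R N) eta1; lra.
  have H2 : t < N%:R / rs / 2.
    by rewrite ltr_pdivlMr // ltr_pdivlMr //; lra.
  by lra.
have eN0 : 0 <= eta * N%:R by rewrite mulr_ge0 // ltW.
have := fluid (fun k n => tau k n w) t N _
  (fun k n => ltW (pos k n)) (ltW t0) eN0 N_t close.
rewrite /speed -/s0; set Z := (proj _)%:~R => HZ.
apply/negP; rewrite -leNgt.
have -> : Z / t - v = (Z - v * t) / t by rewrite mulrBl mulfK ?gt_eqF.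
rewrite normrM (ger0_norm (x := t^-1)) ?invr_ge0 ?(ltW t0) // ler_pdivrMr //.
apply: le_trans HZ _.
have H1 : beta * (rs * (eta * N%:R)) <= beta * (rs * (eta * (2 * rs * t + 1))).
  by rewrite !ler_pM2l.
have H2 : eta * (4 * beta * rs ^+ 2) * t <= eps * t by rewrite ler_pM2r.
have H3 : beta * (eta * (2 * rs)) <= beta by rewrite -[leRHS]mulr1 ler_pM2l.
have H4 : 2 * (alpha + 2 * beta) <= eps * t.
  by rewrite [leRHS]mulrC -ler_pdivrMr //; lra.
have : beta * (rs * (eta * (2 * rs * t + 1))) =
  eta * (4 * beta * rs ^+ 2) * t / 2 + beta * (eta * (2 * rs)) / 2 by field.
by lra.
Qed.

End Convergence.
End Cascade.

Theorem theorem3 (d : measure_display) (T : measurableType d) (R : realType)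
  (P : probability T R) (l1 l2 l3 b12 b23 : R) (a1 a2 a3 : int)
  (tau : 'I_5 -> nat -> T -> R) :
  0 < l1 -> 0 < l2 -> 0 < l3 -> 0 < b12 -> 0 < b23 ->
  (forall k n, measurable_fun setT (tau k n)) ->
  (forall k n (s : R), 0 <= s ->
     P [set w | s < tau k n w] = (expR (- (rates l1 l2 l3 b12 b23 k * s)))%:E) ->
  mutually_independent P (fun kn : 'I_5 * nat => tau kn.1 kn.2) ->
  let s0 := init_state a1 a2 a3 in
  let v1 := speed tau s0 cx1 in
  let v2 := speed tau s0 cx2 in
  let v3 := speed tau s0 cx3 in
  [/\ l1 < Num.min l2 l3 ->
        [/\ cvg_in_prob P v1 l1, cvg_in_prob P v2 l1 & cvg_in_prob P v3 l1],
      l1 < l2 /\ l3 < l1 ->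
        [/\ cvg_in_prob P v1 l1, cvg_in_prob P v2 l1 & cvg_in_prob P v3 l3],
      l2 < Num.min l1 l3 ->
        [/\ cvg_in_prob P v1 l1, cvg_in_prob P v2 l2 & cvg_in_prob P v3 l2]
    & l2 < l1 /\ l3 < l2 ->
        [/\ cvg_in_prob P v1 l1, cvg_in_prob P v2 l2 & cvg_in_prob P v3 l3]].
Proof.
move=> l10 l20 l30 b120 b230 mtau tail indep s0 v1 v2 v3.
have cvg := speed_cvg l1 l2 l3 b12 b23 a1 a2 a3
  l10 l20 l30 b120 b230 P tau mtau tail indep.
have fluid := cascade_fluid l1 l2 l3 b12 b23 a1 a2 a3 l10 l20 l30 b120 b230.
have c1 : cvg_in_prob P v1 l1.
  apply: cvg => p t N e p0 t0 e0 Nt cl.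
  by have [] := fluid p t N e p0 t0 e0 Nt cl.
have c2 : cvg_in_prob P v2 (Num.min l1 l2).
  apply: cvg => p t N e p0 t0 e0 Nt cl.
  by have [] := fluid p t N e p0 t0 e0 Nt cl.
have c3 : cvg_in_prob P v3 (Num.min (Num.min l1 l2) l3).
  apply: cvg => p t N e p0 t0 e0 Nt cl.
  by have [] := fluid p t N e p0 t0 e0 Nt cl.
split.
- rewrite lt_min => /andP[l12 l13]; move: c2 c3.
  by rewrite (min_idPl (ltW l12)) (min_idPl (ltW l13)).
- move=> [l12 l31]; move: c2 c3.
  by rewrite (min_idPl (ltW l12)) (min_idPr (ltW l31)).
- rewrite lt_min => /andP[l21 l23]; move: c2 c3.
  by rewrite (min_idPr (ltW l21)) (min_idPl (ltW l23)).
- move=> [l21 l32]; move: c2 c3.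
  by rewrite (min_idPr (ltW l21)) (min_idPr (ltW l32)).
Qed.
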